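(* For even integers $m\geq 2$, $$\int_{0}^{\infty}\frac{\log\left(x^{2m}+1\right)}{x^2+1}\,dx=\frac{\pi m}{2}\log2+\pi\sum_{k=0}^{\frac{m-2}{2}}\log\left(1+\sqrt{\frac{1-\varphi_k}{2}}\right).$$ For odd integers $m\geq 1$, $$\int_{0}^{\infty}\frac{\log\left(x^{2m}+1\right)}{x^2+1}\,dx=\frac{\pi (m+1)}{2}\log2+\pi\sum_{k=0}^{\frac{m-3}{2}}\log\left(1+\sqrt{\frac{1-\varphi_k}{2}}\right).$$
   Context: For given $m$, $\varphi_k=\cos\left(\frac{(2k+1)\pi}{m}\right)$. An empty sum $\sum_{k=0}^{-1}(\cdot)$ is taken to be zero. *)

(* Defs.v *)
From Stdlib Require Import Reals List.
From Coquelicot Require Import Coquelicot.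
Open Scope R_scope.

Definition phi (m k : nat) : R := cos ((2 * INR k + 1) * PI / INR m).

(** The sum of [f k] for [k] from [0] to [n - 1]; it has [n] terms, so that
    [n = 0] is the empty sum "from 0 to -1". *)
Definition sum_lt (n : nat) (f : nat -> R) : R :=
  fold_right Rplus 0 (map f (seq 0 n)).

(** Improper Riemann integral over [0, +oo): it asserts that the integral
    converges and that its value is [v]. *)
Definition is_RInt_0_infty (f : R -> R) (v : R) : Prop :=
  is_RInt_gen f (at_point 0) (Rbar_locally p_infty) v.

(* Main.v *)
Require Import Defs.
From Stdlib Require Import Reals List Lra Lia.
From Coquelicot Require Import Coquelicot.
Open Scope R_scope.

(** The substitution x = tan t turns the integral into that
    of ln (cos^(2m) t + sin^(2m) t) - 2 m ln (cos t) over [0, pi/2).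

    The integral of ln (2 cos t) vanishes: integrating
    2 cos (pi/4 + u) 2 cos (pi/4 - u) = 2 cos (2 u) gives a relation between its
    partial integrals near pi/2 and near 0.

    For the other part, with a = cos^2 t and b = sin^2 t, a^m + b^m is the product
    of the a^2 - 2 a b phi_k + b^2 (times a + b = 1 for odd m), which follows from
    Chebyshev-like recurrences by counting roots.  Each factor is
    ((1 + s) / 2)^2 (1 + 2 r cos (4 t) + r^2) with s^2 = (1 - phi_k) / 2 and
    r = (1 - s) / (1 + s), and Poisson's integral I(r) of ln (1 + 2 r cos x + r^2)
    over [0, pi] is 0 for |r| < 1 because it is locally bounded and
    2 I(r) = I(r^2). *)

(** * Polynomial functions and root counting *)

(** Horner form: polynomial functions of degree below [n], without coefficient lists; degree below 0
    means the zero function. *)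
Fixpoint deg_lt (n : nat) (f : R -> R) : Prop :=
  match n with
  | O => forall w, f w = 0
  | S n => exists (g : R -> R) (c : R), deg_lt n g /\ forall w, f w = w * g w + c
  end.

Lemma deg_lt_ext n f g : (forall w, f w = g w) -> deg_lt n f -> deg_lt n g.
Proof.
intros E; destruct n as [|n]; simpl.
- intros H w; rewrite <- E; auto.
- intros (h & c & Hh & H); exists h, c; split; auto.
  intros w; rewrite <- E; auto.
Qed.

Lemma deg_lt_lin n a f g :
  deg_lt n f -> deg_lt n g -> deg_lt n (fun w => f w + a * g w).
Proof.
revert f g; induction n as [|n IH]; simpl; intros f g.
- intros Hf Hg w; rewrite Hf, Hg; ring.
- intros (f' & c & Hf' & Hf) (g' & d & Hg' & Hg).
  exists (fun w => f' w + a * g' w), (c + a * d); split; auto.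
  intros w; rewrite Hf, Hg; ring.
Qed.

Lemma deg_lt_S n f : deg_lt n f -> deg_lt (S n) f.
Proof.
revert f; induction n as [|n IH]; intros f.
- intros H; exists (fun _ => 0), 0; split; simpl in *; auto.
  intros w; rewrite H; ring.
- intros (g & c & Hg & H); exists g, c; split; auto.
Qed.

Lemma deg_lt_mulX n f : deg_lt n f -> deg_lt (S n) (fun w => w * f w).
Proof. intros H; exists f, 0; split; auto; intros; ring. Qed.

(** Synthetic division: when [f w = w * g w + c], the quotient of [f] is [g] plus [r] times the
    quotient of [g]. *)
Lemma deg_lt_factor n f r :
  deg_lt (S n) f ->
  exists h, deg_lt n h /\ forall w, f w - f r = (w - r) * h w.
Proof.
revert f; induction n as [|n IH]; intros f (g & c & Hg & Hf).
- exists (fun _ => 0); split; [simpl; auto|].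
  simpl in Hg; intros w; rewrite !Hf, !Hg; ring.
- destruct (IH g Hg) as (h & Hh & E).
  exists (fun w => g w + r * h w); split.
  + apply deg_lt_lin; auto; apply deg_lt_S; auto.
  + intros w; rewrite !Hf.
    replace (w * g w + c - (r * g r + c)) with ((w - r) * g w + r * (g w - g r))
      by ring.
    rewrite E; ring.
Qed.

(** Dividing out the head root leaves a quotient of smaller degree that still vanishes at the other
    roots, as they differ from it. *)
Lemma deg_lt_roots l f :
  NoDup l -> deg_lt (length l) f -> (forall r, In r l -> f r = 0) ->
  forall w, f w = 0.
Proof.
revert f; induction l as [|r l IH]; intros f Hl Hf Hr w.
- apply Hf.
- inversion Hl as [|? ? Hnr Hl']; subst.
  destruct (deg_lt_factor _ _ r Hf) as (h & Hh & E).
  rewrite (Hr r (or_introl eq_refl)) in E.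
  assert (Hhr : forall s, In s l -> h s = 0).
  { intros s Hs.
    assert (Hsr : s - r <> 0) by (intros H; apply Hnr; replace r with s by lra; auto).
    specialize (E s); rewrite (Hr s (or_intror Hs)) in E.
    assert (E' : (s - r) * h s = 0) by lra.
    apply Rmult_integral in E' as [|]; auto; contradiction. }
  specialize (E w); rewrite (IH h Hl' Hh Hhr w) in E; lra.
Qed.

Definition prod_list (l : list R) : R := fold_right Rmult 1 l.

Definition monic (n : nat) (f : R -> R) : Prop := deg_lt n (fun w => f w - w ^ n).

Lemma monic_deg_lt n f : monic n f -> deg_lt (S n) f.
Proof.
intros H.
assert (Hp : deg_lt (S n) (fun w => w ^ n)).
{ clear; induction n as [|n IH].
  - exists (fun _ => 0), 1; simpl; split; auto; intros; ring.
  - apply (deg_lt_mulX (S n)); auto. }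
apply deg_lt_ext with (fun w => (f w - w ^ n) + 1 * w ^ n); [intros; ring|].
apply deg_lt_lin; auto; apply deg_lt_S; auto.
Qed.

Lemma monic_prod l : monic (length l) (fun w => prod_list (map (fun r => w - r) l)).
Proof.
induction l as [|r l IH].
- simpl; intros w; ring.
- unfold monic; simpl length.
  set (P := fun w => prod_list (map (fun r => w - r) l)) in *.
  apply deg_lt_ext with (fun w => w * (P w - w ^ length l) + (- r) * P w).
  + intros w; unfold P; simpl; ring.
  + apply deg_lt_lin; [apply deg_lt_mulX; exact IH | apply monic_deg_lt; exact IH].
Qed.

(** The difference of two monic functions of equal degree has smaller degree, so the common roots
    force it to vanish. *)
Lemma monic_eq_prod l f :
  NoDup l -> monic (length l) f -> (forall r, In r l -> f r = 0) ->
  forall w, f w = prod_list (map (fun r => w - r) l).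
Proof.
intros Hl Hf Hr w.
set (P := fun w => prod_list (map (fun r => w - r) l)).
assert (HP : forall r, In r l -> P r = 0).
{ intros r; unfold P; clear; induction l as [|t l IH]; simpl; [tauto|].
  intros [<-|H]; [|rewrite IH by auto]; ring. }
enough (H : f w + (-1) * P w = 0) by (unfold P in H; lra).
apply (deg_lt_roots l (fun w => f w + (-1) * P w)); auto.
- apply deg_lt_ext with (fun w => (f w - w ^ length l) + (-1) * (P w - w ^ length l)).
  + intros; ring.
  + apply deg_lt_lin; auto; apply monic_prod.
- intros r H; rewrite Hr, HP by auto; ring.
Qed.

(** * Chebyshev-like recurrences *)

(* With w = x^2 + x^-2, the value is x^(2n) + x^(-2n) for c = 2, and
   (x^(2n+1) + x^(-2n-1)) / (x + 1/x) for c = 1. *)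
Fixpoint cheb (c : R) (n : nat) (w : R) : R :=
  match n with
  | O => c
  | S n' => match n' with
            | O => w + c - 2
            | S n'' => w * cheb c n' w - cheb c n'' w
            end
  end.

Lemma cheb_SS c n w : cheb c (S (S n)) w = w * cheb c (S n) w - cheb c n w.
Proof. reflexivity. Qed.

(** The index starts at 1 because [cheb c 0] is the constant [c], which is monic only for
    [c = 1]. *)
Lemma monic_cheb c n : monic (S n) (cheb c (S n)).
Proof.
(* The recurrence has order two, so the induction also carries the degree of the preceding term. *)
enough (H : monic (S n) (cheb c (S n)) /\ deg_lt (S n) (cheb c n)) by tauto.
induction n as [|n [IH1 IH2]].
- split.
  + exists (fun _ => 0), (c - 2); simpl; split; auto; intros; ring.
  + exists (fun _ => 0), c; simpl; split; auto; intros; ring.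
- split; [|apply monic_deg_lt; auto].
  apply deg_lt_ext with
    (fun w => w * (cheb c (S n) w - w ^ S n) + (-1) * cheb c n w).
  + intros w; rewrite cheb_SS; simpl; ring.
  + apply deg_lt_lin; [apply deg_lt_mulX; auto | apply deg_lt_S; auto].
Qed.

Lemma nat_ind2 (P : nat -> Prop) :
  P 0%nat -> P 1%nat -> (forall n, P n -> P (S n) -> P (S (S n))) -> forall n, P n.
Proof.
intros H0 H1 HS n; enough (P n /\ P (S n)) by tauto.
induction n as [|n [? ?]]; auto.
Qed.

(** The closed form at x = e^(it/2); it exhibits the roots. *)
Lemma cheb2_cos n t : cheb 2 n (2 * cos t) = 2 * cos (INR n * t).
Proof.
induction n as [| |n IH1 IH2] using nat_ind2.
- simpl; rewrite Rmult_0_l, cos_0; ring.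
- simpl; rewrite Rmult_1_l; ring.
- rewrite cheb_SS, IH1, IH2, !S_INR.
  replace ((INR n + 1 + 1) * t) with ((INR n + 1) * t + t) by ring.
  replace (INR n * t) with ((INR n + 1) * t - t) by ring.
  rewrite cos_plus, cos_minus; ring.
Qed.

(** The closed form at x = e^(it), where [cos t] is half of the denominator x + 1/x. *)
Lemma cheb1_cos n t :
  cos t * cheb 1 n (2 * cos (2 * t)) = cos ((2 * INR n + 1) * t).
Proof.
induction n as [| |n IH1 IH2] using nat_ind2.
- simpl; rewrite Rmult_0_r, Rplus_0_l, Rmult_1_l; ring.
- simpl; replace ((2 * 1 + 1) * t) with (2 * t + t) by ring.
  rewrite cos_plus, sin_2a, cos_2a_cos.
  replace (2 * sin t * cos t * sin t) with (2 * (sin t)² * cos t) by (unfold Rsqr; ring).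
  rewrite sin2; unfold Rsqr; ring.
- rewrite cheb_SS.
  replace (cos t * (2 * cos (2 * t) * cheb 1 (S n) (2 * cos (2 * t))
                    - cheb 1 n (2 * cos (2 * t))))
    with (2 * cos (2 * t) * (cos t * cheb 1 (S n) (2 * cos (2 * t)))
          - cos t * cheb 1 n (2 * cos (2 * t))) by ring.
  rewrite IH1, IH2, !S_INR.
  replace ((2 * (INR n + 1 + 1) + 1) * t)
    with ((2 * (INR n + 1) + 1) * t + 2 * t) by ring.
  replace ((2 * INR n + 1) * t) with ((2 * (INR n + 1) + 1) * t - 2 * t) by ring.
  rewrite cos_plus, cos_minus; ring.
Qed.

(** The closed form at x^2 = a/b, scaled by (ab)^n. *)
Lemma cheb2_pow n a b : a * b <> 0 ->
  a ^ (2 * n) + b ^ (2 * n) = (a * b) ^ n * cheb 2 n ((a ^ 2 + b ^ 2) / (a * b)).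
Proof.
intros H; rewrite !pow_mult.
induction n as [| |n IH1 IH2] using nat_ind2.
- simpl; ring.
- simpl; field; split; intros ->; apply H; ring.
- rewrite cheb_SS.
  replace ((a * b) ^ S (S n)) with ((a * b) * (a * b) ^ S n) at 1 by (simpl; ring).
  set (w := (a ^ 2 + b ^ 2) / (a * b)) in *.
  replace (a * b * (a * b) ^ S n * (w * cheb 2 (S n) w - cheb 2 n w))
    with (w * (a * b) * ((a * b) ^ S n * cheb 2 (S n) w)
          - (a * b) ^ 2 * ((a * b) ^ n * cheb 2 n w)) by (rewrite <- (tech_pow_Rmult _ n); ring).
  rewrite <- IH1, <- IH2.
  replace (w * (a * b)) with (a ^ 2 + b ^ 2) by (unfold w; field;
    split; intros ->; apply H; ring).
  simpl; ring.
Qed.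

Lemma cheb1_pow n a b : a * b <> 0 ->
  a ^ (2 * n + 1) + b ^ (2 * n + 1)
  = (a + b) * ((a * b) ^ n * cheb 1 n ((a ^ 2 + b ^ 2) / (a * b))).
Proof.
intros H; rewrite !pow_add, !pow_mult, !pow_1.
induction n as [| |n IH1 IH2] using nat_ind2.
- simpl; ring.
- simpl; field; split; intros ->; apply H; ring.
- rewrite cheb_SS.
  replace ((a * b) ^ S (S n)) with ((a * b) * (a * b) ^ S n) at 1 by (simpl; ring).
  set (w := (a ^ 2 + b ^ 2) / (a * b)) in *.
  replace ((a + b) * (a * b * (a * b) ^ S n * (w * cheb 1 (S n) w - cheb 1 n w)))
    with (w * (a * b) * ((a + b) * ((a * b) ^ S n * cheb 1 (S n) w))
          - (a * b) ^ 2 * ((a + b) * ((a * b) ^ n * cheb 1 n w))) by (rewrite <- (tech_pow_Rmult _ n); ring).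
  rewrite <- IH1, <- IH2.
  replace (w * (a * b)) with (a ^ 2 + b ^ 2) by (unfold w; field;
    split; intros ->; apply H; ring).
  simpl; ring.
Qed.

(** * Factorization of a^m + b^m *)

(** Places the angles where the cosine is injective, so that the roots are distinct; positivity also
    keeps [phi] below 1. *)
Lemma phi_angle m k : (2 * k + 1 <= m)%nat ->
  0 < (2 * INR k + 1) * PI / INR m <= PI.
Proof.
intros H; apply le_INR in H.
rewrite plus_INR, mult_INR in H; simpl in H.
pose proof (pos_INR k) as Hk; pose proof PI_RGT_0 as HP.
assert (Hm : 0 < INR m) by lra.
split.
- apply Rdiv_lt_0_compat; nra.
- apply Rmult_le_reg_r with (INR m); auto.
  unfold Rdiv; rewrite Rmult_assoc, Rinv_l by lra; nra.
Qed.

Lemma NoDup_phi m n : (2 * n <= m)%nat ->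
  NoDup (map (fun k => 2 * phi m k) (seq 0 n)).
Proof.
intros H; apply NoDup_map_NoDup_ForallPairs; [|apply seq_NoDup].
intros k l Hk Hl E.
apply in_seq in Hk; apply in_seq in Hl.
assert (E' : phi m k = phi m l) by lra; clear E.
apply INR_eq.
assert (Hm : 0 < INR m) by (apply lt_0_INR; lia).
assert (Hpos := PI_RGT_0).
assert (Ak := phi_angle m k ltac:(lia)); assert (Al := phi_angle m l ltac:(lia)).
apply cos_inj in E'; [|lra|lra].
apply Rmult_eq_reg_r in E'; [|apply Rinv_neq_0_compat; lra].
apply Rmult_eq_reg_r in E'; lra.
Qed.

Lemma prod_homog w c l : c <> 0 ->
  c ^ length l * prod_list (map (fun r => w / c - r) l)
  = prod_list (map (fun r => w - c * r) l).
Proof.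
intros Hc; induction l as [|r l IH]; simpl; [ring|].
rewrite <- IH; field; auto.
Qed.

Lemma cos_odd_half_PI k : cos ((2 * INR k + 1) * (PI / 2)) = 0.
Proof.
apply cos_eq_0_1; exists (Z.of_nat k); rewrite <- INR_IZR_INZ; field.
Qed.

(** The angle of [phi (2 * n) k] times [n] is an odd multiple of pi/2, so [cheb 2 n] vanishes at
    [2 * phi (2 * n) k]. For [n = 0] the two sides would be 2 and 1. *)
Lemma pow_plus_pow_even n a b : a * b <> 0 -> (1 <= n)%nat ->
  a ^ (2 * n) + b ^ (2 * n)
  = prod_list (map (fun k => a ^ 2 + b ^ 2 - a * b * (2 * phi (2 * n) k)) (seq 0 n)).
Proof.
intros H Hn.
set (l := map (fun k => 2 * phi (2 * n) k) (seq 0 n)).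
assert (Hl : length l = n) by (unfold l; rewrite length_map, length_seq; auto).
rewrite cheb2_pow by auto.
rewrite (monic_eq_prod l (cheb 2 n)).
- rewrite <- Hl at 1; rewrite prod_homog by auto.
  unfold l; rewrite map_map; auto.
- apply NoDup_phi; lia.
- rewrite Hl; destruct n as [|n]; [lia|apply monic_cheb].
- intros r Hr; apply in_map_iff in Hr as (k & <- & Hk).
  unfold phi; rewrite cheb2_cos, mult_INR.
  replace (INR n * ((2 * INR k + 1) * PI / (INR 2 * INR n)))
    with ((2 * INR k + 1) * (PI / 2)).
  + rewrite cos_odd_half_PI; ring.
  + simpl; field; apply not_0_INR; lia.
Qed.

(** Here [n = 0] is included, since [cheb 1 0] is the empty product 1. *)
Lemma pow_plus_pow_odd n a b : a * b <> 0 ->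
  a ^ (2 * n + 1) + b ^ (2 * n + 1)
  = (a + b) *
    prod_list (map (fun k => a ^ 2 + b ^ 2 - a * b * (2 * phi (2 * n + 1) k)) (seq 0 n)).
Proof.
intros H.
set (l := map (fun k => 2 * phi (2 * n + 1) k) (seq 0 n)).
assert (Hl : length l = n) by (unfold l; rewrite length_map, length_seq; auto).
rewrite cheb1_pow by auto; f_equal.
rewrite (monic_eq_prod l (cheb 1 n)).
- rewrite <- Hl at 1; rewrite prod_homog by auto.
  unfold l; rewrite map_map; auto.
- apply NoDup_phi; lia.
- rewrite Hl; destruct n as [|n]; [|apply monic_cheb].
  intros w; simpl; ring.
- intros r Hr; apply in_map_iff in Hr as (k & <- & Hk); apply in_seq in Hk.
  unfold phi.
  set (t := (2 * INR k + 1) * PI / INR (2 * n + 1)).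
  assert (Ht : 0 < t < PI).
  { unfold t; pose proof PI_RGT_0; split; [apply phi_angle; lia|].
    assert (Hkn : INR k < INR n) by (apply lt_INR; lia).
    rewrite plus_INR, mult_INR; simpl; pose proof (pos_INR k).
    apply Rmult_lt_reg_r with (2 * INR n + 1); [lra|].
    unfold Rdiv; rewrite Rmult_assoc, Rinv_l by lra; nra. }
  (* Since [t] is strictly below pi, the cofactor [cos (t / 2)] in [cheb1_cos] can be cancelled. *)
  assert (Hc : 0 < cos (t / 2)) by (apply cos_gt_0; lra).
  apply Rmult_eq_reg_l with (cos (t / 2)); [|lra].
  replace (cos t) with (cos (2 * (t / 2))) by (f_equal; field).
  rewrite cheb1_cos, Rmult_0_r.
  replace ((2 * INR n + 1) * (t / 2)) with ((2 * INR k + 1) * (PI / 2)).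
  + apply cos_odd_half_PI.
  + unfold t; rewrite plus_INR, mult_INR; simpl; field.
    pose proof (pos_INR n); lra.
Qed.

(** * Changes of variable in integrals *)

(** Exposes the real operations behind the algebraic structures and abstracts each integral to a
    variable, so that [field] applies. *)
Ltac R_field :=
  unfold plus, opp, scal; simpl; unfold mult; simpl;
  repeat match goal with
         | |- context [@RInt ?V ?f ?a ?b] =>
           let I := fresh "I" in
           pose (I := (@RInt V f a b : R)); change (@RInt V f a b) with I; clearbody I
         end;
  match goal with |- @eq _ ?x ?y => change (@eq R x y) end; field.

Lemma Rabs_ln_le c y : 0 < c -> c <= y -> y <= / c -> Rabs (ln y) <= - ln c.
Proof.
intros Hc H1 H2.
apply Rabs_le; split.
- rewrite Ropp_involutive; apply ln_le; lra.
- rewrite <- ln_Rinv by lra; apply ln_le; lra.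
Qed.

Lemma ex_RInt_cont (f : R -> R) a b : (forall x, continuous f x) -> ex_RInt f a b.
Proof. intros H; apply (ex_RInt_continuous (V := R_CompleteNormedModule)); auto. Qed.

Lemma RInt_affine (f : R -> R) u v a b : u <> 0 -> (forall x, continuous f x) ->
  RInt (fun x => f (u * x + v)) a b = / u * RInt f (u * a + v) (u * b + v).
Proof.
intros Hu Hf.
rewrite <- (RInt_comp_lin f u v a b) by (apply ex_RInt_cont; auto).
rewrite RInt_scal.
- R_field; auto.
- apply ex_RInt_cont; intros x.
  apply continuous_comp with (f := fun x => u * x + v); auto.
  apply (ex_derive_continuous (fun x => u * x + v)); auto_derive; auto.
Qed.

(** The reflection x -> pi - x. *)
Lemma RInt_cos_opp (g : R -> R) : (forall x, continuous (fun x => g (cos x)) x) ->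
  RInt (fun x => g (- cos x)) 0 PI = RInt (fun x => g (cos x)) 0 PI.
Proof.
intros Hg.
transitivity (RInt (fun x => g (cos (-1 * x + PI))) 0 PI).
- apply RInt_ext; intros x _; f_equal.
  replace (-1 * x + PI) with (- (x + - PI)) by ring.
  rewrite cos_neg, cos_plus, cos_neg, sin_neg, cos_PI, sin_PI; ring.
- rewrite (RInt_affine (fun x => g (cos x))) by (auto; lra).
  replace (-1 * 0 + PI) with PI by ring.
  replace (-1 * PI + PI) with 0 by ring.
  rewrite <- (opp_RInt_swap (fun x => g (cos x)) 0 PI) by (apply ex_RInt_cont; auto).
  R_field.
Qed.

(** Rescaling gives half the integral over [0, 2 pi], whose two halves agree under x -> 2 pi - x. *)
Lemma RInt_cos_double (g : R -> R) : (forall x, continuous (fun x => g (cos x)) x) ->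
  RInt (fun x => g (cos (2 * x))) 0 PI = RInt (fun x => g (cos x)) 0 PI.
Proof.
intros Hg.
transitivity (RInt (fun x => g (cos (2 * x + 0))) 0 PI).
{ apply RInt_ext; intros x _; do 2 f_equal; ring. }
rewrite (RInt_affine (fun x => g (cos x))) by (auto; lra).
replace (2 * 0 + 0) with 0 by ring.
replace (2 * PI + 0) with (2 * PI) by ring.
rewrite <- (RInt_Chasles (fun x => g (cos x)) 0 PI (2 * PI))
  by (apply ex_RInt_cont; auto).
replace (RInt (fun x => g (cos x)) PI (2 * PI)) with (RInt (fun x => g (cos x)) 0 PI).
{ R_field. }
transitivity (RInt (fun x => g (cos (-1 * x + 2 * PI))) PI (2 * PI)).
- rewrite (RInt_affine (fun x => g (cos x))) by (auto; lra).
  replace (-1 * PI + 2 * PI) with PI by ring.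
  replace (-1 * (2 * PI) + 2 * PI) with 0 by ring.
  rewrite <- (opp_RInt_swap (fun x => g (cos x)) 0 PI) by (apply ex_RInt_cont; auto).
  R_field.
- apply RInt_ext; intros x _; f_equal.
  replace (-1 * x + 2 * PI) with (- (x - 2 * PI)) by ring.
  rewrite cos_neg, cos_minus, cos_2PI, sin_2PI; ring.
Qed.

Lemma RInt_cos_quadruple (g : R -> R) : (forall x, continuous (fun x => g (cos x)) x) ->
  RInt (fun t => g (cos (4 * t))) 0 (PI / 2) = / 2 * RInt (fun x => g (cos x)) 0 PI.
Proof.
intros Hg.
transitivity (RInt (fun x => g (cos (2 * (2 * x + 0)))) 0 (PI / 2)).
{ apply RInt_ext; intros x _; do 2 f_equal; ring. }
rewrite (RInt_affine (fun x => g (cos (2 * x)))); [|lra|].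
- replace (2 * 0 + 0) with 0 by ring.
  replace (2 * (PI / 2) + 0) with PI by field.
  rewrite RInt_cos_double; auto.
- intros x; apply continuous_comp with (f := fun x => 2 * x) (g := fun x => g (cos x)); auto.
  apply (ex_derive_continuous (fun x => 2 * x)); auto_derive; auto.
Qed.

(** * Poisson's integral *)

(** The outer bounds are reciprocal, so one constant bounds the absolute value of the logarithm for
    all |r| <= p. *)
Lemma poisson_bounds r p c : Rabs r <= p -> p < 1 -> -1 <= c <= 1 ->
  0 < (1 - p) ^ 2 /\ (1 - p) ^ 2 <= 1 + 2 * r * c + r ^ 2 <= / (1 - p) ^ 2.
Proof.
intros Hr Hp Hc.
apply Rabs_le_between in Hr.
assert (H0 : 0 < (1 - p) ^ 2) by (apply pow_lt; lra).
assert (H1 : 1 + 2 * r * c + r ^ 2 <= (1 + p) ^ 2) by nra.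
assert (H2 : (1 + p) ^ 2 <= / (1 - p) ^ 2).
{ apply Rmult_le_reg_r with ((1 - p) ^ 2); auto.
  rewrite Rinv_l by lra.
  replace ((1 + p) ^ 2 * (1 - p) ^ 2) with ((1 - p ^ 2) ^ 2) by ring.
  assert (0 <= p ^ 2 <= 1) by nra; nra. }
repeat split; auto; [|lra].
destruct (Rle_dec 0 r); nra.
Qed.

Lemma continuous_poisson r x : Rabs r < 1 ->
  continuous (fun x => ln (1 + 2 * r * cos x + r ^ 2)) x.
Proof.
intros Hr; apply (ex_derive_continuous (fun x => ln (1 + 2 * r * cos x + r ^ 2))).
auto_derive.
destruct (poisson_bounds r (Rabs r) (cos x)) as (? & ? & ?); try lra.
apply COS_bound.
Qed.

Definition poisson (r : R) : R := RInt (fun x => ln (1 + 2 * r * cos x + r ^ 2)) 0 PI.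

Lemma poisson_opp r : Rabs r < 1 -> poisson (- r) = poisson r.
Proof.
intros Hr; unfold poisson.
rewrite <- (RInt_cos_opp (fun c => ln (1 + 2 * r * c + r ^ 2))).
- apply RInt_ext; intros; f_equal; ring.
- intros; apply continuous_poisson; auto.
Qed.

(** The arguments of the logarithm at r and -r multiply to 1 - 2 r^2 cos (2x) + r^4, the argument
    for -r^2 at 2x. *)
Lemma poisson_sqr r : Rabs r < 1 -> 2 * poisson r = poisson (r ^ 2).
Proof.
intros Hr.
assert (Hr2 : Rabs (r ^ 2) < 1).
{ rewrite <- RPow_abs; pose proof (Rabs_pos r); nra. }
replace (2 * poisson r) with (poisson r + poisson (- r))
  by (rewrite poisson_opp by auto; ring).
rewrite <- (poisson_opp (r ^ 2)) by auto.
assert (Hn : Rabs (- r) < 1) by (rewrite Rabs_Ropp; auto).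
assert (Hn2 : Rabs (- r ^ 2) < 1) by (rewrite Rabs_Ropp; auto).
unfold poisson.
rewrite <- (RInt_cos_double (fun c => ln (1 + 2 * (- r ^ 2) * c + (- r ^ 2) ^ 2)))
  by (intros; apply continuous_poisson; auto).
etransitivity.
{ symmetry; apply (RInt_plus (V := R_CompleteNormedModule));
  apply ex_RInt_cont; intros; apply continuous_poisson; auto. }
apply RInt_ext; intros x _; unfold plus; simpl.
destruct (poisson_bounds r (Rabs r) (cos x)) as (? & ? & ?);
  [lra | auto | apply COS_bound |].
destruct (poisson_bounds (- r) (Rabs (- r)) (cos x)) as (? & ? & ?);
  [lra | auto | apply COS_bound |].
rewrite <- ln_mult by (simpl in *; lra); f_equal.
rewrite cos_2a_cos; ring.
Qed.

(** Squaring keeps |r| <= p, so the same crude bound serves after n squarings, each of which gains a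
    factor 2. *)
Lemma poisson_bound p : p < 1 -> forall n r, Rabs r <= p ->
  Rabs (poisson r) <= PI * - ln ((1 - p) ^ 2) / 2 ^ n.
Proof.
intros Hp; induction n as [|n IH]; intros r Hr.
- unfold Rdiv; simpl pow at 2; rewrite Rinv_1, Rmult_1_r.
  replace PI with (PI - 0) at 1 by ring; apply abs_RInt_le_const.
  + apply Rlt_le, PI_RGT_0.
  + apply ex_RInt_cont; intros; apply continuous_poisson; lra.
  + intros x _.
    destruct (poisson_bounds r p (cos x)) as (? & ? & ?); auto.
    * apply COS_bound.
    * apply Rabs_ln_le; auto.
- replace (poisson r) with (/ 2 * poisson (r ^ 2))
    by (rewrite <- poisson_sqr by lra; field).
  rewrite Rabs_mult, (Rabs_pos_eq (/ 2)) by lra.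
  replace (PI * - ln ((1 - p) ^ 2) / 2 ^ S n)
    with (/ 2 * (PI * - ln ((1 - p) ^ 2) / 2 ^ n))
    by (simpl; field; apply pow_nonzero; lra).
  apply Rmult_le_compat_l; [lra|]; apply IH.
  rewrite <- RPow_abs; pose proof (Rabs_pos r); nra.
Qed.

Lemma half_pow_bound_0 x C : (forall n, Rabs x <= C / 2 ^ n) -> x = 0.
Proof.
intros H.
destruct (Req_dec x 0) as [|Hx]; auto; exfalso.
apply Rabs_pos_lt in Hx.
destruct (Pow_x_infinity 2 (ltac:(rewrite Rabs_pos_eq; lra)) (C / Rabs x + 1)) as (n & Hn).
specialize (Hn n (Nat.le_refl n)); specialize (H n).
assert (H2 : 0 < 2 ^ n) by (apply pow_lt; lra).
rewrite (Rabs_pos_eq (2 ^ n)) in Hn by lra.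
apply (Rmult_le_compat_r (2 ^ n)) in H; [|lra].
unfold Rdiv in H; rewrite Rmult_assoc, Rinv_l, Rmult_1_r in H by lra.
apply Rge_le in Hn; apply (Rmult_le_compat_l (Rabs x)) in Hn; [|lra].
replace (Rabs x * (C / Rabs x + 1)) with (C + Rabs x) in Hn by (field; lra).
lra.
Qed.

Lemma poisson_0 r : Rabs r < 1 -> poisson r = 0.
Proof.
intros Hr; eapply half_pow_bound_0; intros n.
apply (poisson_bound (Rabs r)); lra.
Qed.

(** * The integral of one factor *)

(** As a + b = 1, the left side is 1 - 2 (1 + p) ab, and ab = sin^2 (2t) / 4 = (1 - cos (4t)) /
    8. *)
Lemma quartic_factor a b t p : a = cos t ^ 2 -> b = sin t ^ 2 ->
  a ^ 2 + b ^ 2 - a * b * (2 * p) = 1 - (1 + p) / 4 * (1 - cos (4 * t)).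
Proof.
intros -> ->.
replace (4 * t) with (2 * (2 * t)) by ring.
rewrite cos_2a_sin, sin_2a.
generalize (sin2_cos2 t); unfold Rsqr; intros E.
replace (sin t ^ 2) with (1 - cos t * cos t) by lra.
replace (1 - 2 * (2 * sin t * cos t) * (2 * sin t * cos t))
  with (1 - 8 * (sin t * sin t) * (cos t * cos t)) by ring.
replace (sin t * sin t) with (1 - cos t * cos t) by lra.
field.
Qed.

(** Both sides equal (1 + s^2) / 2 + c (1 - s^2) / 2. *)
Lemma quartic_poisson p c : -1 <= p < 1 ->
  let s := sqrt ((1 - p) / 2) in let r := (1 - s) / (1 + s) in
  1 - (1 + p) / 4 * (1 - c) = ((1 + s) / 2) ^ 2 * (1 + 2 * r * c + r ^ 2).
Proof.
intros Hp s r.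
assert (Hs : 0 <= s) by apply sqrt_pos.
assert (Hs2 : s * s = (1 - p) / 2) by (apply sqrt_sqrt; lra).
replace p with (1 - 2 * (s * s)) at 1 by lra.
unfold r; field; lra.
Qed.

Lemma is_RInt_quartic p : -1 <= p < 1 ->
  is_RInt (fun t => ln (1 - (1 + p) / 4 * (1 - cos (4 * t)))) 0 (PI / 2)
    (PI * ln ((1 + sqrt ((1 - p) / 2)) / 2)).
Proof.
intros Hp.
set (s := sqrt ((1 - p) / 2)); set (r := (1 - s) / (1 + s)).
(* Strict positivity of [s], from [p < 1], is what keeps |r| strictly below 1. *)
assert (Hs : 0 < s) by (apply sqrt_lt_R0; lra).
assert (Hr : Rabs r < 1).
{ apply Rabs_def1; unfold r; apply Rmult_lt_reg_r with (1 + s); try lra;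
  unfold Rdiv; rewrite Rmult_assoc, Rinv_l; lra. }
assert (Hc : forall t, continuous (fun t => ln (1 + 2 * r * cos (4 * t) + r ^ 2)) t).
{ intros t.
  apply continuous_comp with (f := fun t => 4 * t)
    (g := fun x => ln (1 + 2 * r * cos x + r ^ 2)).
  - apply (ex_derive_continuous (fun t => 4 * t)); auto_derive; auto.
  - apply continuous_poisson; auto. }
apply is_RInt_ext with
  (fun t => plus (2 * ln ((1 + s) / 2)) (ln (1 + 2 * r * cos (4 * t) + r ^ 2))).
- intros t _; unfold plus; simpl.
  rewrite (quartic_poisson p (cos (4 * t)) Hp); fold s; fold r.
  destruct (poisson_bounds r (Rabs r) (cos (4 * t))) as (? & ? & ?);
    [lra | auto | apply COS_bound |].
  rewrite ln_mult by (try apply pow_lt; lra).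
  rewrite ln_pow by lra; simpl; ring.
- replace (PI * ln ((1 + s) / 2))
    with (plus (scal (PI / 2 - 0) (2 * ln ((1 + s) / 2)))
            (RInt (fun t => ln (1 + 2 * r * cos (4 * t) + r ^ 2)) 0 (PI / 2))).
  + apply (is_RInt_plus (V := R_NormedModule)).
    * apply (is_RInt_const (V := R_NormedModule)).
    * apply (RInt_correct (V := R_CompleteNormedModule)), ex_RInt_cont; auto.
  + rewrite (RInt_cos_quadruple (fun c => ln (1 + 2 * r * c + r ^ 2)))
      by (intros; apply continuous_poisson; auto).
    fold (poisson r); rewrite poisson_0 by auto.
    R_field.
Qed.

(** * The log-cosine integral *)

Lemma continuous_ln_2cos t : - (PI / 2) < t < PI / 2 ->
  continuous (fun t => ln (2 * cos t)) t.
Proof.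
intros Ht; apply (ex_derive_continuous (fun t => ln (2 * cos t))).
auto_derive; assert (0 < cos t) by (apply cos_gt_0; lra); lra.
Qed.

(** The factor 2 normalizes the limit at pi/2 to 0. *)
Definition int_ln_2cos (T : R) : R := RInt (fun t => ln (2 * cos t)) 0 T.

Lemma ex_RInt_ln_2cos T : - (PI / 2) < T < PI / 2 ->
  ex_RInt (fun t => ln (2 * cos t)) 0 T.
Proof.
intros HT; apply (ex_RInt_continuous (V := R_CompleteNormedModule)); intros t Ht.
apply continuous_ln_2cos; pose proof PI_RGT_0.
unfold Rmin, Rmax in Ht; destruct (Rle_dec 0 T); lra.
Qed.

Lemma is_derive_int_ln_2cos T : - (PI / 2) < T < PI / 2 ->
  is_derive int_ln_2cos T (ln (2 * cos T)).
Proof.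
intros HT; apply is_derive_RInt with (a := 0) (f := fun t => ln (2 * cos t)).
- assert (Ho : open (fun x : R => - (PI / 2) < x /\ x < PI / 2)).
  { apply open_and; [apply open_gt | apply open_lt]. }
  apply (filter_imp (F := locally T)
           (fun x : R => - (PI / 2) < x /\ x < PI / 2)); [|apply Ho; auto].
  intros x Hx; apply (RInt_correct (V := R_CompleteNormedModule)).
  apply ex_RInt_ln_2cos; auto.
- apply continuous_ln_2cos; auto.
Qed.

(* The duplication formula 4 cos(pi/4 + u) cos(pi/4 - u) = 2 cos(2u), integrated. *)
Lemma int_ln_2cos_duplication u : 0 <= u < PI / 4 ->
  int_ln_2cos (PI / 4 + u) - int_ln_2cos (PI / 4 - u) = / 2 * int_ln_2cos (2 * u).
Proof.
intros Hu.
assert (HP := PI_RGT_0).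
(* [F] vanishes at 0 and has zero derivative on [0, u], so it is constant there. *)
set (F := fun u => int_ln_2cos (PI / 4 + u) - int_ln_2cos (PI / 4 - u)
                   - / 2 * int_ln_2cos (2 * u)).
assert (F0 : F 0 = 0).
{ unfold F; rewrite Rplus_0_r, Rminus_0_r, Rmult_0_r.
  replace (int_ln_2cos 0) with 0; [ring|].
  symmetry; apply (RInt_point (V := R_CompleteNormedModule)). }
enough (H : F 0 = F u) by (rewrite F0 in H; unfold F in H; lra).
destruct (Req_dec u 0) as [->|Hu0]; auto.
apply (eq_is_derive F); [|lra].
intros t Ht.
assert (D1 := is_derive_int_ln_2cos (PI / 4 + t) ltac:(lra)).
assert (D2 := is_derive_int_ln_2cos (PI / 4 - t) ltac:(lra)).
assert (D3 := is_derive_int_ln_2cos (2 * t) ltac:(lra)).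
unfold F; auto_derive.
- repeat split; eexists; eassumption.
- change (PI / 4 + - t) with (PI / 4 - t).
  rewrite (is_derive_unique (fun x : R => int_ln_2cos x) _ _ D3).
  rewrite (is_derive_unique (fun x : R => int_ln_2cos x) _ _ D1).
  rewrite (is_derive_unique (fun x : R => int_ln_2cos x) _ _ D2).
  assert (C1 : 0 < cos (PI / 4 + t)) by (apply cos_gt_0; lra).
  assert (C2 : 0 < cos (PI / 4 - t)) by (apply cos_gt_0; lra).
  assert (E : 2 * cos (2 * t) = 2 * cos (PI / 4 + t) * (2 * cos (PI / 4 - t))).
  { rewrite cos_plus, cos_minus, cos_PI4, sin_PI4, cos_2a.
    assert (0 < sqrt 2) by (apply sqrt_lt_R0; lra).
    assert (S2 : sqrt 2 * sqrt 2 = 2) by (apply sqrt_sqrt; lra).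
    replace (2 * (1 / sqrt 2 * cos t - 1 / sqrt 2 * sin t)
             * (2 * (1 / sqrt 2 * cos t + 1 / sqrt 2 * sin t)))
      with (4 / (sqrt 2 * sqrt 2) * (cos t * cos t - sin t * sin t)) by (field; lra).
    rewrite S2; field. }
  rewrite E, (ln_mult (2 * cos (PI / 4 + t))) by lra; unfold zero; simpl; field.
Qed.

(** On [0, pi/4], 1 <= 2 cos t <= 2 < e, so the integrand lies in [0, 1]. *)
Lemma int_ln_2cos_small T : 0 <= T <= PI / 4 -> Rabs (int_ln_2cos T) <= T.
Proof.
intros HT.
assert (HP := PI_RGT_0).
replace T with ((T - 0) * 1) at 2 by ring.
apply abs_RInt_le_const; [lra | apply ex_RInt_ln_2cos; lra |].
intros t Ht.
assert (C : / 2 <= cos t).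
{ replace (/ 2) with (cos (PI / 3)) by (rewrite cos_PI3; field).
  apply cos_decr_1; lra. }
pose proof (COS_bound t).
assert (L0 : 0 <= ln (2 * cos t)) by (rewrite <- ln_1; apply ln_le; lra).
assert (L1 : ln (2 * cos t) <= ln (exp 1))
  by (apply ln_le; [lra|]; pose proof (exp_ineq1 1 ltac:(lra)); lra).
rewrite ln_exp in L1; rewrite Rabs_pos_eq; lra.
Qed.

(* The duplication formula bounds the left-hand side h(e) by h(2 e) / 2 + e,
   and 4 sqrt e is a supersolution of this recursion. *)
Lemma int_ln_2cos_near_PI2 e : 0 < e <= PI / 2 ->
  Rabs (int_ln_2cos (PI / 2 - e)) <= 4 * sqrt e.
Proof.
assert (HP := PI_RGT_0); assert (HP4 := PI_4).
(* Induction on a number of doublings that brings [e] up to pi/4. *)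
assert (dyadic : forall n e, PI / 4 <= e * 2 ^ n -> 0 < e <= PI / 2 ->
          Rabs (int_ln_2cos (PI / 2 - e)) <= 4 * sqrt e).
{ clear e; induction n as [|n IH]; intros e Hn He.
  - rewrite pow_O, Rmult_1_r in Hn.
    apply Rle_trans with (PI / 2 - e); [apply int_ln_2cos_small; lra|].
    assert (S1 : 0 <= sqrt e) by apply sqrt_pos.
    assert (S2 : sqrt e * sqrt e = e) by (apply sqrt_sqrt; lra).
    pose proof PI2_3_2; nra.
  - destruct (Rle_dec (PI / 4) e) as [Hbig|Hsmall].
    { apply IH; auto; apply Rle_trans with e; auto.
      rewrite <- (Rmult_1_r e) at 1; apply Rmult_le_compat_l; [lra|].
      apply pow_R1_Rle; lra. }
    assert (D := int_ln_2cos_duplication (PI / 4 - e) ltac:(lra)).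
    replace (PI / 4 + (PI / 4 - e)) with (PI / 2 - e) in D by field.
    replace (PI / 4 - (PI / 4 - e)) with e in D by ring.
    replace (2 * (PI / 4 - e)) with (PI / 2 - 2 * e) in D by field.
    assert (B1 := int_ln_2cos_small e ltac:(lra)).
    assert (B2 := IH (2 * e) ltac:(simpl in Hn; lra) ltac:(lra)).
    assert (S1 : 0 < sqrt e) by (apply sqrt_lt_R0; lra).
    assert (S2 : sqrt e * sqrt e = e) by (apply sqrt_sqrt; lra).
    (* With sqrt 2 <= 3/2 the recursion yields e + 3 sqrt e, which is at most 4 sqrt e because e <=
       1. *)
    assert (S3 : sqrt (2 * e) <= 3 / 2 * sqrt e).
    { rewrite sqrt_mult by lra; apply Rmult_le_compat_r; [lra|].
      rewrite <- (sqrt_Rsqr (3 / 2)) by lra; apply sqrt_le_1_alt; unfold Rsqr; lra. }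
    assert (S4 : e <= sqrt e) by nra.
    apply Rabs_le_between in B1; apply Rabs_le_between in B2.
    apply Rabs_le; lra. }
intros He.
destruct (Pow_x_infinity 2 (ltac:(rewrite Rabs_pos_eq; lra)) (PI / 4 / e)) as (n & Hn).
specialize (Hn n (Nat.le_refl n)).
apply (dyadic n); auto.
rewrite Rabs_pos_eq in Hn by (apply pow_le; lra).
apply Rge_le in Hn; apply (Rmult_le_compat_l e) in Hn; [|lra].
replace (e * (PI / 4 / e)) with (PI / 4) in Hn by (field; lra); lra.
Qed.

(** * Limits at pi/2 *)

Lemma filterlim_atan_p_infty :
  filterlim atan (Rbar_locally p_infty) (at_left (PI / 2)).
Proof.
intros P (d & Hd).
assert (HP := PI_RGT_0); assert (Hd0 := cond_pos d).
(* The cap pi/4 keeps [T] in the range where [atan] inverts [tan]. *)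
set (T := PI / 2 - Rmin d (PI / 4)).
assert (Hm : 0 < Rmin d (PI / 4)) by (apply Rmin_pos; lra).
pose proof (Rmin_l d (PI / 4)); pose proof (Rmin_r d (PI / 4)).
exists (tan T); intros x Hx.
assert (Hat := atan_bound x).
assert (Hlt : T < atan x).
{ rewrite <- (atan_tan T) by (unfold T; lra); apply atan_increasing; auto. }
apply Hd; [|lra].
apply Rabs_def1; unfold minus, plus, opp, T in *; simpl in *; lra.
Qed.

Lemma filterlim_int_ln_2cos : filterlim int_ln_2cos (at_left (PI / 2)) (locally 0).
Proof.
apply filterlim_locally; intros eps.
assert (HP := PI_RGT_0); assert (He := cond_pos eps).
assert (He2 : 0 < (eps / 4) ^ 2) by (apply pow_lt; lra).
(* At distance (eps/4)^2 the bound [4 * sqrt e] reaches [eps]; the cap pi/2 is the range of that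
   bound. *)
set (d := Rmin (PI / 2) ((eps / 4) ^ 2)).
assert (Hd : 0 < d) by (apply Rmin_pos; lra).
pose proof (Rmin_l (PI / 2) ((eps / 4) ^ 2)); pose proof (Rmin_r (PI / 2) ((eps / 4) ^ 2)).
assert (B : forall T, Rabs (T - PI / 2) < d -> T < PI / 2 -> Rabs (int_ln_2cos T) < eps).
{ intros T HT HTl; apply Rabs_lt_between in HT.
  assert (B := int_ln_2cos_near_PI2 (PI / 2 - T) ltac:(unfold d in *; lra)).
  replace (PI / 2 - (PI / 2 - T)) with T in B by ring.
  assert (S : sqrt (PI / 2 - T) < eps / 4).
  { rewrite <- (sqrt_pow2 (eps / 4)) by lra; apply sqrt_lt_1_alt; unfold d in *; lra. }
  lra. }
exists (mkposreal d Hd); intros T HT HTl.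
unfold ball; simpl; unfold AbsRing_ball, minus, plus, opp, abs; simpl.
rewrite Ropp_0, Rplus_0_r; apply B; auto.
Qed.

(** * The substitution x = tan t *)

Lemma pow_even_sum_pos m t : 0 < cos t ^ (2 * m) + sin t ^ (2 * m).
Proof.
rewrite !pow_mult.
assert (Hs := pow2_ge_0 (sin t)); assert (Hc := pow2_ge_0 (cos t)).
assert (E := sin2_cos2 t); unfold Rsqr in E.
assert (P1 := pow_le _ m Hs); assert (P2 := pow_le _ m Hc).
destruct (Req_dec (cos t) 0) as [H|H].
- assert (0 < (sin t ^ 2) ^ m); [|lra].
  apply pow_lt; rewrite H in E; simpl; lra.
- assert (0 < (cos t ^ 2) ^ m); [|lra].
  apply pow_lt; apply pow2_gt_0; auto.
Qed.

(** The part of the transformed integrand that has no singularity at pi/2. *)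
Definition ln_trig (m : nat) (t : R) : R := ln (cos t ^ (2 * m) + sin t ^ (2 * m)).

Lemma continuous_ln_trig m t : continuous (ln_trig m) t.
Proof.
apply (ex_derive_continuous (ln_trig m)); unfold ln_trig.
assert (H := pow_even_sum_pos m t).
auto_derive; auto.
Qed.

Lemma is_derive_RInt_ln_trig m T :
  is_derive (fun T => RInt (ln_trig m) 0 T) T (ln_trig m T).
Proof.
apply is_derive_RInt with (a := 0).
- apply filter_forall; intros x; apply (RInt_correct (V := R_CompleteNormedModule)).
  apply ex_RInt_cont, continuous_ln_trig.
- apply continuous_ln_trig.
Qed.

(** Subtracting [T * ln 2] turns the integral of ln (2 cos t) into that of ln (cos t). *)
Definition primitive (m : nat) (T : R) : R :=
  RInt (ln_trig m) 0 T - 2 * INR m * (int_ln_2cos T - T * ln 2).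

(** At T = atan x, sin T = x cos T, so [ln_trig m T] is 2m ln (cos T) + ln (x^(2m) + 1). The cosine
    terms cancel, and the derivative of [atan] supplies the denominator. *)
Lemma is_derive_primitive_atan m x :
  is_derive (fun x => primitive m (atan x)) x (ln (x ^ (2 * m) + 1) / (x ^ 2 + 1)).
Proof.
set (T := atan x).
assert (HT : - PI / 2 < T < PI / 2) by apply atan_bound.
assert (HC : 0 < cos T) by (apply cos_gt_0; lra).
assert (D1 := is_derive_RInt_ln_trig m T).
assert (D2 := is_derive_int_ln_2cos T ltac:(lra)).
assert (D : is_derive (primitive m) T
              (ln_trig m T - 2 * INR m * (ln (2 * cos T) - ln 2))).
{ unfold primitive.
  apply (is_derive_minus (fun T => RInt (ln_trig m) 0 T)
           (fun T => 2 * INR m * (int_ln_2cos T - T * ln 2))); auto.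
  auto_derive; [eexists; eassumption|].
  rewrite (is_derive_unique (fun x : R => int_ln_2cos x) _ _ D2); ring. }
assert (Dc := is_derive_comp (primitive m) atan x _ _ D (is_derive_atan x)).
replace (ln (x ^ (2 * m) + 1) / (x ^ 2 + 1))
  with (scal (/ (1 + x²)) (ln_trig m T - 2 * INR m * (ln (2 * cos T) - ln 2))).
{ exact Dc. }
assert (Hs : sin T = x * cos T).
{ rewrite <- (tan_atan x) at 1; fold T; unfold tan; field; lra. }
assert (Hx : 0 < x ^ (2 * m) + 1).
{ rewrite pow_mult; pose proof (pow_le _ m (pow2_ge_0 x)); lra. }
assert (E : ln_trig m T = 2 * INR m * ln (cos T) + ln (x ^ (2 * m) + 1)).
{ unfold ln_trig; rewrite Hs, Rpow_mult_distr.
  replace (cos T ^ (2 * m) + x ^ (2 * m) * cos T ^ (2 * m))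
    with (cos T ^ (2 * m) * (x ^ (2 * m) + 1)) by ring.
  rewrite ln_mult, ln_pow, mult_INR by (auto; apply pow_lt; auto).
  simpl; ring. }
rewrite E, ln_mult by lra.
unfold scal; simpl; unfold mult; simpl; unfold Rsqr.
field; pose proof (Rle_0_sqr x); unfold Rsqr in *; simpl in *; lra.
Qed.

(** The log-cosine part tends to 0, the rest is continuous at pi/2, and 2m T ln 2 becomes pi m ln 2
    there. *)
Lemma filterlim_primitive_atan m :
  filterlim (fun x => primitive m (atan x)) (Rbar_locally p_infty)
    (locally (RInt (ln_trig m) 0 (PI / 2) + PI * INR m * ln 2)).
Proof.
apply (filterlim_comp _ _ _ atan (primitive m) _ _ _ filterlim_atan_p_infty).
set (v := RInt (ln_trig m) 0 (PI / 2) + PI * INR m * ln 2).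
set (h := fun T => RInt (ln_trig m) 0 T + 2 * INR m * ln 2 * T).
assert (Hh : filterlim h (at_left (PI / 2)) (locally (h (PI / 2)))).
{ apply (filterlim_filter_le_1 (F := locally (PI / 2)) (G := at_left (PI / 2))).
  - apply filter_le_within.
  - assert (D := is_derive_RInt_ln_trig m (PI / 2)).
    apply (ex_derive_continuous h); unfold h.
    apply (ex_derive_plus (fun T => RInt (ln_trig m) 0 T) (fun T => 2 * INR m * ln 2 * T)).
    + eexists; exact D.
    + auto_derive; auto. }
replace v with (h (PI / 2) + (- (2 * INR m)) * 0) by (unfold h, v; field).
apply filterlim_ext with (fun T => plus (h T) (mult (- (2 * INR m)) (int_ln_2cos T))).
{ intros T; unfold plus, mult, h, primitive; simpl; ring. }
apply (filterlim_comp_2 (H := locally ((- (2 * INR m)) * 0))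
         h (fun T => mult (- (2 * INR m)) (int_ln_2cos T)) plus Hh).
- apply (filterlim_comp _ _ _ int_ln_2cos (mult (- (2 * INR m))) _ _ _ filterlim_int_ln_2cos).
  apply (filterlim_scal_r (V := R_NormedModule) (- (2 * INR m)) 0).
- apply (filterlim_plus (V := R_NormedModule)).
Qed.

Lemma is_RInt_0_infty_primitive (f F : R -> R) (v : R) :
  (forall x, is_derive F x (f x)) -> (forall x, continuous f x) ->
  filterlim F (Rbar_locally p_infty) (locally (v + F 0)) ->
  is_RInt_0_infty f v.
Proof.
intros HD HC HL P HP.
assert (HL' : filterlim (fun x => F x - F 0) (Rbar_locally p_infty) (locally v)).
{ replace v with (plus (v + F 0) (- F 0)) by (unfold plus; simpl; ring).
  apply (filterlim_comp_2 (H := locally (- F 0)) F (fun _ => - F 0) plus HL).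
  - apply filterlim_const.
  - apply (filterlim_plus (V := R_NormedModule)). }
(* The lower filter is concentrated at 0, so only integrals starting at [a = 0] have to be
   computed. *)
apply Filter_prod with (Q := fun a => a = 0) (R := fun x => P (F x - F 0)).
- unfold at_point; auto.
- exact (HL' P HP).
- intros a x -> Hx; exists (F x - F 0); split; auto.
  apply (is_RInt_derive (V := R_CompleteNormedModule)); auto.
Qed.

Lemma is_RInt_0_infty_ln_pow m :
  is_RInt_0_infty (fun x => ln (x ^ (2 * m) + 1) / (x ^ 2 + 1))
    (RInt (ln_trig m) 0 (PI / 2) + PI * INR m * ln 2).
Proof.
apply is_RInt_0_infty_primitive with (fun x => primitive m (atan x)).
- apply is_derive_primitive_atan.
- intros x; apply (ex_derive_continuous (fun x => ln (x ^ (2 * m) + 1) / (x ^ 2 + 1))).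
  assert (0 < x ^ (2 * m) + 1).
  { rewrite pow_mult; pose proof (pow_le _ m (pow2_ge_0 x)); lra. }
  pose proof (pow2_ge_0 x); auto_derive; simpl in *; repeat split; lra.
- replace (primitive m (atan 0)) with 0.
  + rewrite Rplus_0_r; apply filterlim_primitive_atan.
  + rewrite atan_0; unfold primitive, int_ln_2cos.
    rewrite !RInt_point; unfold zero; simpl; ring.
Qed.

(** * Summation over the factors *)

(** Each factor contributes pi ln ((1 + s) / 2); its denominator 2 goes into the ln 2 term. *)
Lemma is_RInt_ln_prod (p : nat -> R) (l : list nat) :
  (forall k, In k l -> -1 <= p k < 1) ->
  is_RInt (fun t => ln (prod_list (map (fun k => 1 - (1 + p k) / 4 * (1 - cos (4 * t))) l)))
    0 (PI / 2)
    (PI * fold_right Rplus 0 (map (fun k => ln (1 + sqrt ((1 - p k) / 2))) l)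
     - INR (length l) * PI * ln 2).
Proof.
intros Hp; induction l as [|k l IH].
- simpl; rewrite ln_1.
  replace (PI * 0 - 0 * PI * ln 2) with (scal (PI / 2 - 0) 0)
    by (unfold scal; simpl; unfold mult; simpl; ring).
  apply (is_RInt_const (V := R_NormedModule)).
(* For p < 1 the subtracted term is below 1/2 * 2 = 1; this positivity lets the logarithm split. *)
- assert (Hf : forall j t, -1 <= p j < 1 ->
             0 < 1 - (1 + p j) / 4 * (1 - cos (4 * t))).
  { intros j t Hj; pose proof (COS_bound (4 * t)); nra. }
  assert (HPi := PI_RGT_0).
  apply is_RInt_ext with (fun t => plus (ln (1 - (1 + p k) / 4 * (1 - cos (4 * t))))
    (ln (prod_list (map (fun k => 1 - (1 + p k) / 4 * (1 - cos (4 * t))) l)))).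
  + intros t _; simpl; rewrite ln_mult; [auto | |].
    * apply Hf, Hp; left; auto.
    * assert (Hl : forall j, In j l -> -1 <= p j < 1) by (intros; apply Hp; right; auto).
      clear - Hf Hl HPi; induction l as [|j l IHl]; simpl; [lra|].
      apply Rmult_lt_0_compat.
      -- apply Hf, Hl; left; auto.
      -- apply IHl; intros; apply Hl; right; auto.
  + assert (Hs := sqrt_pos ((1 - p k) / 2)).
    assert (E : ln ((1 + sqrt ((1 - p k) / 2)) / 2)
                = ln (1 + sqrt ((1 - p k) / 2)) - ln 2) by (apply ln_div; lra).
    match goal with |- is_RInt _ _ _ ?v =>
      replace v with
        (plus (PI * ln ((1 + sqrt ((1 - p k) / 2)) / 2))
           (PI * fold_right Rplus 0 (map (fun k => ln (1 + sqrt ((1 - p k) / 2))) l)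
            - INR (length l) * PI * ln 2)) end.
    * apply (is_RInt_plus (V := R_NormedModule)).
      -- apply is_RInt_quartic, Hp; left; auto.
      -- apply IH; intros; apply Hp; right; auto.
    * rewrite E; simpl length; rewrite S_INR; unfold plus; simpl; ring.
Qed.

Lemma phi_bound m k : (2 * k + 1 <= m)%nat -> -1 <= phi m k < 1.
Proof.
intros H; apply phi_angle in H as [H0 H1].
unfold phi; split; [apply COS_bound|].
revert H0 H1; generalize ((2 * INR k + 1) * PI / INR m); intros t H0 H1.
pose proof PI_RGT_0; rewrite <- cos_0; apply cos_decreasing_1; lra.
Qed.

(** Common to both parities, which enter only through the assumed factorization. *)
Lemma RInt_ln_trig m n : (2 * n <= m)%nat ->
  (forall a b, 0 < a -> 0 < b -> a + b = 1 ->
     a ^ m + b ^ m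
     = prod_list (map (fun k => a ^ 2 + b ^ 2 - a * b * (2 * phi m k)) (seq 0 n))) ->
  RInt (ln_trig m) 0 (PI / 2)
  = PI * sum_lt n (fun k => ln (1 + sqrt ((1 - phi m k) / 2))) - INR n * PI * ln 2.
Proof.
intros Hn Hprod; apply (is_RInt_unique (V := R_CompleteNormedModule)).
unfold sum_lt; rewrite <- (length_seq n 0) at 2.
eapply is_RInt_ext; [|apply is_RInt_ln_prod].
- intros t Ht; assert (HP := PI_RGT_0).
  (* Only interior points are compared, so [cos t] and [sin t] are both positive. *)
  rewrite Rmin_left, Rmax_right in Ht by lra.
  unfold ln_trig; f_equal; symmetry.
  rewrite !pow_mult, Hprod.
  + f_equal; apply map_ext; intros k; apply quartic_factor; auto.
  + apply pow_lt, cos_gt_0; lra.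
  + apply pow_lt, sin_gt_0; lra.
  + pose proof (sin2_cos2 t) as E; unfold Rsqr in E; simpl; lra.
- intros k Hk; apply in_seq in Hk; apply phi_bound; lia.
Qed.

(* The upper summation limits (m-2)/2 = m/2 - 1 and (m-3)/2 = (m-1)/2 - 1
   correspond to m/2 and (m-1)/2 terms. *)
Theorem theorem2p11 :
  (forall m : nat, Nat.Even m -> (2 <= m)%nat ->
     is_RInt_0_infty (fun x : R => ln (x ^ (2 * m) + 1) / (x ^ 2 + 1))
       (PI * INR m / 2 * ln 2
        + PI * sum_lt (m / 2)
                 (fun k : nat => ln (1 + sqrt ((1 - phi m k) / 2)))))
  /\
  (forall m : nat, Nat.Odd m -> (1 <= m)%nat ->
     is_RInt_0_infty (fun x : R => ln (x ^ (2 * m) + 1) / (x ^ 2 + 1))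
       (PI * (INR m + 1) / 2 * ln 2
        + PI * sum_lt ((m - 1) / 2)
                 (fun k : nat => ln (1 + sqrt ((1 - phi m k) / 2))))).
Proof.
split; intros m [n Hm] Hle.
- replace (m / 2)%nat with n by (rewrite Hm, Nat.mul_comm, Nat.div_mul; lia).
  assert (E := RInt_ln_trig m n ltac:(lia)).
  assert (L := is_RInt_0_infty_ln_pow m).
  rewrite E in L.
  + eapply eq_ind; [exact L|].
    (* For m = 2n, the ln 2 terms combine as m - n = m/2. *)
    rewrite Hm, mult_INR; simpl; field.
  + intros a b Ha Hb _; rewrite Hm; apply pow_plus_pow_even; [|lia].
    apply Rgt_not_eq, Rmult_lt_0_compat; auto.
- replace ((m - 1) / 2)%nat with n
    by (rewrite Hm, Nat.add_sub, Nat.mul_comm, Nat.div_mul; lia).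
  assert (E := RInt_ln_trig m n ltac:(lia)).
  assert (L := is_RInt_0_infty_ln_pow m).
  rewrite E in L.
  + eapply eq_ind; [exact L|].
    (* For m = 2n + 1, they combine as m - n = (m + 1)/2. *)
    rewrite Hm, plus_INR, mult_INR; simpl; field.
  + intros a b Ha Hb Hab; rewrite Hm, pow_plus_pow_odd, Hab, Rmult_1_l; auto.
    apply Rgt_not_eq, Rmult_lt_0_compat; auto.
Qed.
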